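(* Suppose that $\mathfrak u<\mathrm{cf}^\ast(\mathrm{Sym}(\omega))$. Then every two ultrafilters on $\omega$ that are not coherent to $Q$-points are coherent. In particular, if there is no $Q$-point, then NCF holds.
   Context: All filters are assumed non-principal. $\mathfrak u$ is the minimal size of a family generating (i.e. a base of) a non-principal ultrafilter on $\omega$. Ultrafilters $\mathcal F$ and $\mathcal U$ on $\omega$ are coherent if there is an increasing sequence $\langle k_n:n\in\omega\rangle$ of natural numbers such that for every $I\subset\omega$, $\bigcup_{n\in I}[k_n,k_{n+1})\in\mathcal F$ if and only if $\bigcup_{n\in I}[k_n,k_{n+1})\in\mathcal U$. NCF is the statement that all (non-principal) ultrafilters on $\omega$ are coherent to each other. An ultrafilter $\mathcal L$ is a $Q$-point if for every monotone (nondecreasing) surjection $\phi:\omega\to\omega$ there is $L\in\mathcal L$ such that $\phi\restriction L$ is injective. $\mathrm{Sym}(\omega)$ is the group of all permutations of $\omega$. For $x,y\in\omega^\omega$, $x\leq^\ast y$ means $x(n)\leq y(n)$ for all but finitely many $n$. For an increasing function $f\in\omega^\omega$, $S_f$ is the subgroup of $\mathrm{Sym}(\omega)$ generated by $\{\pi\in\mathrm{Sym}(\omega):\pi,\pi^{-1}\leq^\ast f\}$. $\mathrm{cf}^\ast(\mathrm{Sym}(\omega))$ is the minimal length $\lambda$ of an increasing (with respect to inclusion) chain $\langle G_i:i<\lambda\rangle$ of proper subgroups of $\mathrm{Sym}(\omega)$ with $\bigcup_{i<\lambda}G_i=\mathrm{Sym}(\omega)$ such that for every increasing $f\in\omega^\omega$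 there is $i<\lambda$ with $S_f\subset G_i$. *)

(* Defs.v *)
From HB Require Import structures.
From mathcomp Require Import all_boot.
From mathcomp Require Import boolp classical_sets functions cardinality filter.
From mathcomp Require Import wochoice.

Set Implicit Arguments.
Unset Strict Implicit.
Unset Printing Implicit Defensive.

Local Open Scope classical_set_scope.
Local Open Scope card_scope.

Definition increasing (f : nat -> nat) := {homo f : m n / m < n}.

Definition nondecreasing (f : nat -> nat) := {homo f : m n / m <= n}.

Definition nonprincipal_ultrafilter (F : set_system nat) :=
  UltraFilter F /\ forall n, F <> principal_filter n.

Definition block_union (k : nat -> nat) (I : set nat) : set nat :=
  \bigcup_(n in I) [set m | k n <= m < k n.+1].

Definition coherent (F U : set_system nat) :=
  exists2 k : nat -> nat, increasing k &
    forall I : set nat, F (block_union k I) <-> U (block_union k I).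

Definition NCF := forall F U : set_system nat,
  nonprincipal_ultrafilter F -> nonprincipal_ultrafilter U -> coherent F U.

Definition Q_point (F : set_system nat) :=
  nonprincipal_ultrafilter F /\
  forall phi : nat -> nat, nondecreasing phi -> range phi = setT ->
    exists2 A, F A & {in A &, injective phi}.

Record Sym := MkSym {
  sym_fun :> nat -> nat;
  sym_inv : nat -> nat;
  sym_funK : cancel sym_fun sym_inv;
  sym_invK : cancel sym_inv sym_fun }.

Lemma sym_ext (p q : Sym) : p =1 q -> p = q.
Proof.
move=> pq; have ipq : sym_inv p = sym_inv q.
  by apply/funext => n; rewrite -[n in LHS](sym_invK q) -pq sym_funK.
move: pq ipq; case: p q => [f g fK gK] [f' g' fK' gK'] /= /funext ff' gg'.
by subst f' g'; congr MkSym; exact: Prop_irrelevance.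
Qed.

HB.instance Definition _ := gen_eqMixin Sym.
HB.instance Definition _ := gen_choiceMixin Sym.

Definition sym_one : Sym := @MkSym id id (fun=> erefl) (fun=> erefl).

Definition sym_opp (p : Sym) : Sym := MkSym (sym_invK p) (sym_funK p).

(* (p * q) n = p (q n) *)
Definition sym_mul (p q : Sym) : Sym :=
  MkSym (can_comp (sym_funK p) (sym_funK q))
        (can_comp (sym_invK q) (sym_invK p)).

Lemma sym_mulA : associative sym_mul.
Proof. by move=> p q r; apply: sym_ext. Qed.

Lemma sym_mul1 : left_id sym_one sym_mul.
Proof. by move=> p; apply: sym_ext. Qed.

Lemma sym_mulr1 : right_id sym_one sym_mul.
Proof. by move=> p; apply: sym_ext. Qed.

Lemma sym_mulV : left_inverse sym_one sym_opp sym_mul.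
Proof. by move=> p; apply: sym_ext => n; exact: sym_funK. Qed.

Lemma sym_mulrV : right_inverse sym_one sym_opp sym_mul.
Proof. by move=> p; apply: sym_ext => n; exact: sym_invK. Qed.

HB.instance Definition _ :=
  isGroup.Build Sym sym_mulA sym_mul1 sym_mulr1 sym_mulV sym_mulrV.

Definition subgroup (G : set Sym) := group_closed [in G].

Definition le_star (x y : nat -> nat) := finite_set [set n | ~~ (x n <= y n)].

Definition S_ (f : nat -> nat) : set Sym :=
  smallest subgroup [set p : Sym | le_star p f /\ le_star (p^-1)%g f].

(* Ordinals are represented by well-ordered types (L, R); R is the reflexive
   order.  The ordinals below (L, R) are the types of its proper initial
   segments. *)
Definition strict (L : Type) (R : rel L) : rel L := fun i j => ~~ R j i.

(* For well orders, a strictly monotone map exists from the first to the second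
   iff the first ordinal is at most the second. *)
Definition ordinal_le (L L' : Type) (R : rel L) (R' : rel L') :=
  exists f : L -> L', {homo f : i j / strict R i j >-> strict R' i j}.

(* |K| < (L, R) as ordinals, where |K| is the initial ordinal equipotent with K *)
Definition card_lt_ordinal (K L : Type) (R : rel L) :=
  exists i : L, [set: K] #= [set j | strict R j i].

Definition ultrafilter_base (B : set (set nat)) :=
  nonprincipal_ultrafilter (filter_from B id).

(* |K| = u *)
Definition is_u (K : Type) :=
  (exists2 B, ultrafilter_base B & [set: K] #= B) /\
  forall B, ultrafilter_base B -> [set: K] #<= B.

Definition cfstar_chain (L : Type) (R : rel L) (G : L -> set Sym) :=
  [/\ forall i, subgroup (G i) /\ G i <> setT,
      forall i j, strict R i j -> G i `<` G j,
      \bigcup_i G i = setT &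
      forall f, increasing f -> exists i, S_ f `<=` G i].

(* (L, R) = cf^*(Sym(nat)) *)
Definition is_cfstar (L : Type) (R : rel L) :=
  [/\ well_order R, exists G, cfstar_chain R G &
      forall (L' : Type) (R' : rel L') (G : L' -> set Sym),
        well_order R' -> cfstar_chain R' G -> ordinal_le R R'].

(* Main.v *)
Require Import Defs.
From mathcomp Require Import all_boot.
From mathcomp Require Import zify.
From mathcomp Require Import boolp classical_sets functions cardinality filter.
From mathcomp Require Import wochoice.

(** Fix an ultrafilter [V] with a base [B] of size u.  It suffices to show that
    every ultrafilter [F] not coherent to a Q-point captures [V] in the
    following sense ([captures]): there is one function [h] such that, for
    every [X] in [V], [F]-almost every [n] has an element of [X] in ]n, h n].
    Indeed, if [F] and [U] both satisfy this, cut [nat] along a sequence [c] that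
    outgrows both functions; merging the blocks three by three, with an offset
    chosen to suit [F] and [U], makes [n] and the element of [X] found above it
    lie in the same block.  Hence [F] and [V] contain the same unions of blocks,
    and so do [U] and [V], for the same partition ([coherent_of_captures]).

    Suppose then that [F] does not capture [V].  For a set [X], let [slow_group F X]
    consist of the permutations [p] for which some [A] in [F] satisfies: [p] and
    its inverse map [0, n[ into [0, m[ whenever n < m are in [A] and separated
    by an element of [X].
    - It is a group ([slow_group_subgroup]): thinning [A] so as to skip every
      other interval of [X] that it meets leaves a point of [A] between any two
      separated points, which absorbs a composition.
    - Two such groups are comparable ([slow_group_total]), as [F] decides which
      of the two sets has its next element first.
    - It is proper when [X] is unbounded ([slow_group_proper]): otherwise it
      contains a permutation escaping arbitrarily fast, and this makes the image
      of [F] under n |-> max (X /\ [0, n]), which is coherent to [F], a Q-point.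
    - Each [S_ f] lies in [slow_group F X] for some [X] in [B]
      ([S_sub_slow_group]): as the windows ]n, f n] do not capture [V], some
      [X] in [B] avoids these windows for [F]-almost all [n].

    The groups [slow_group F X] for [X] in [B] thus yield a chain as in the
    definition of cf^*, of length at most u, against u < cf^*
    ([no_short_chain]). *)

Set Implicit Arguments.
Unset Strict Implicit.
Unset Printing Implicit Defensive.

Local Open Scope classical_set_scope.

(** * Sequences of natural numbers and ultrafilters *)

Lemma increasing_leq (c : nat -> nat) : increasing c -> {homo c : m n / m <= n}.
Proof.
move=> c_inc m n; rewrite leq_eqVlt => /predU1P[->//|/c_inc]; exact: ltnW.
Qed.

Lemma sparse_seq (P : set nat) (u : nat -> nat) :
  (forall n, exists2 b, P b & n < b) ->
  exists c, [/\ increasing c, c 0 = 0, forall i, P (c i.+1) &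
                forall i, u (c i) < c i.+1].
Proof.
move=> P_unb.
have /choice[g gP] n : exists b, P b /\ maxn n (u n) < b.
  by have [b Pb ltb] := P_unb (maxn n (u n)); exists b.
exists (fun i => iter i g 0); split => //.
- by apply: (homo_ltn ltn_trans) => i /=; have [_] := gP (iter i g 0); lia.
- by move=> i; have [] := gP (iter i g 0).
- by move=> i /=; have [_] := gP (iter i g 0); lia.
Qed.

Lemma block_exists (c : nat -> nat) n :
  increasing c -> c 0 <= n -> exists i, c i <= n < c i.+1.
Proof.
move=> c_inc; elim: n => [|n IHn] c0n; first by exists 0; have := c_inc 0 1; lia.
have [c0n'|] := leqP (c 0) n; last by exists 0; have := c_inc 0 1; lia.
have [i /andP[cin nci]] := IHn c0n'.
have [ltni|] := ltnP n.+1 (c i.+1); first by exists i; lia.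
by exists i.+1; have := c_inc i.+1 i.+2; lia.
Qed.

Lemma block_unique (c : nat -> nat) n i j : increasing c ->
  c i <= n < c i.+1 -> c j <= n < c j.+1 -> i = j.
Proof.
move=> c_inc hi hj; have [ij|ji|//] := ltngtP i j.
- by have := increasing_leq c_inc ij; lia.
- by have := increasing_leq c_inc ji; lia.
Qed.

Lemma ultrafilter_cofinite F N :
  nonprincipal_ultrafilter F -> F [set n | N <= n].
Proof.
move=> [FU F_np]; elim: N => [|N IHN].
  by rewrite (_ : [set _ | _] = setT) ?eqEsubset //; exact: filterT.
have [FN|FnN] := in_ultra_setVsetC [set N] FU.
  exfalso; apply: (F_np N); rewrite predeqE => A; split => [FA|/principal_filterP AN].
    by have [_ [-> AN]] := filter_ex (filterI FN FA); apply/principal_filterP.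
  by apply: filterS FN => _ ->.
apply: filterS (filterI IHN FnN) => n /= [Nn nN].
by rewrite ltn_neqAle Nn andbT; apply/eqP => /esym.
Qed.

Lemma pushforward_ultrafilter (s : nat -> nat) F :
  UltraFilter F -> UltraFilter (fmap s F).
Proof.
move=> FU; split; first exact: fmap_proper_filter.
move=> G GF FG; rewrite predeqE => A; split; last exact: FG.
move=> GA; have [//|FnA] := in_ultra_setVsetC (s @^-1` A) FU.
by have [x []] := filter_ex (filterI GA (FG (~` A) FnA)).
Qed.

(** * Coherence through a captured ultrafilter *)

(** The elements of [F] trace every element of [V] closely: for each [X] in [V],
    [F]-almost every [n] has a member of [X] in the window ]n, h n]. *)
Definition captures (F V : set_system nat) (h : nat -> nat) :=
  forall X, V X -> F [set n | exists2 b, X b & n < b <= h n].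

(** A window ]n, h n] starting in the [i]-th block of [c] ends before
    [c (i + 2)], so the only endpoint of [c] that it can contain is [c (i + 1)].
    [F] sees only indices [i] congruent to [rho] modulo 3, for which [c (i + 1)]
    is not an endpoint of the coarser sequence [c (3 t + r)]; the window then
    lies in a single block of that sequence. *)
Lemma captures_block_union F V h c rho r :
  nonprincipal_ultrafilter F -> nonprincipal_ultrafilter V ->
  captures F V h -> increasing c ->
  (forall n i, n < c i.+1 -> h n < c i.+2) ->
  F [set n | exists2 i, c i <= n < c i.+1 & i %% 3 = rho] ->
  r < 3 -> r != rho.+1 %% 3 ->
  forall I, F (block_union (fun t => c (3 * t + r)) I)
        <-> V (block_union (fun t => c (3 * t + r)) I).
Proof.
move=> Fnp Vnp capt c_inc hc Frho r3 r_rho; set k := fun t => c (3 * t + r).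
have [[FU _] [VU _]] := (Fnp, Vnp).
have k_inc : increasing k by move=> m n mn; apply: c_inc; lia.
have VF I : V (block_union k I) -> F (block_union k I).
  move=> /capt FI; apply: filterS (filterI FI Frho).
  move=> n [[b [t It /= ktb] nb] [i cin irho]]; exists t => //=.
  apply/andP; split; last by lia.
  rewrite leqNgt; apply/negP => nkt.
  have hn : h n < c i.+2 by apply: hc; lia.
  have it : 3 * t + r < i.+2.
    rewrite ltnNge; apply/negP => /(increasing_leq c_inc).
    by move: ktb; rewrite /k; lia.
  have ti : i < 3 * t + r.
    rewrite ltnNge; apply/negP => /(increasing_leq c_inc).
    by move: nkt; rewrite /k; lia.
  by move: r_rho; rewrite -irho; lia.
move=> I; split => [FI|]; last exact: VF.
have [//|VnI] := in_ultra_setVsetC (block_union k I) VU.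
have /VF FnI : V (block_union k (~` I)).
  apply: filterS (filterI VnI (ultrafilter_cofinite (k 0) Vnp)).
  move=> n [nI /= k0n]; have [t kt] := block_exists k_inc k0n.
  by exists t => // It; apply: nI; exists t.
have [n [[t It /= kt] [t' nIt' /= kt']]] := filter_ex (filterI FI FnI).
by case: nIt'; rewrite -(block_unique k_inc kt kt').
Qed.

Lemma coherent_of_captures F U V h h' :
  nonprincipal_ultrafilter F -> nonprincipal_ultrafilter U ->
  nonprincipal_ultrafilter V ->
  captures F V h -> captures U V h' -> coherent F U.
Proof.
move=> Fnp Unp Vnp FV UV.
pose H n := \max_(i < n.+1) maxn (h i) (h' i).
have HP m n : m <= n -> maxn (h m) (h' m) <= H n.
  by move=> mn; exact: (leq_bigmax (Ordinal (mn : m < n.+1))).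
have [|c [c_inc c0 _ cH]] := @sparse_seq setT H; first by move=> n; exists n.+1.
have residue W : nonprincipal_ultrafilter W ->
    exists rho, W [set n | exists2 i, c i <= n < c i.+1 & i %% 3 = rho].
  move=> [WU _]; pose D rho := [set n | exists2 i, c i <= n < c i.+1 & i %% 3 = rho].
  have [W0|W0] := in_ultra_setVsetC (D 0) WU; first by exists 0.
  have [W1|W1] := in_ultra_setVsetC (D 1) WU; first by exists 1.
  exists 2; apply: filterS (filterI W0 W1) => n [n0 n1].
  have [|i cin] := @block_exists c n c_inc; first by rewrite c0.
  have i0 : i %% 3 <> 0 by move=> i0; apply: n0; exists i.
  have i1 : i %% 3 <> 1 by move=> i1; apply: n1; exists i.
  by exists i => //; lia.
(* Each of [F] and [U] rules out one offset, which leaves one among three. *)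
have [rho Frho] := residue F Fnp; have [rho' Urho'] := residue U Unp.
have [r [r3 r_rho r_rho']] :
    exists r, [/\ r < 3, r != rho.+1 %% 3 & r != rho'.+1 %% 3].
  have [|] := boolP ((0 != rho.+1 %% 3) && (0 != rho'.+1 %% 3)); first by exists 0; split; lia.
  have [|] := boolP ((1 != rho.+1 %% 3) && (1 != rho'.+1 %% 3)); first by exists 1; split; lia.
  by exists 2; split; lia.
exists (fun t => c (3 * t + r)); first by move=> m n mn; apply: c_inc; lia.
move=> I; apply: (iff_trans (B := V (block_union (fun t => c (3 * t + r)) I))).
  apply: captures_block_union Fnp Vnp FV c_inc _ Frho r3 r_rho I => n i nci.
  by have := HP n (c i.+1); have := cH i.+1; lia.
apply: iff_sym; apply: captures_block_union Unp Vnp UV c_inc _ Urho' r3 r_rho' I.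
by move=> n i nci; have := HP n (c i.+1); have := cH i.+1; lia.
Qed.

(** * The subgroup attached to an ultrafilter and a set *)

Definition separated (X : set nat) n m := exists2 b, X b & n < b <= m.

Lemma separated_widen X n n' m m' :
  n' <= n -> m <= m' -> separated X n m -> separated X n' m'.
Proof. by move=> n'n mm' [b Xb nbm]; exists b => //; lia. Qed.

(** Permutations [p] such that, for n and m in some set of [F], [p] and its inverse
    map [0, n[ into [0, m[ as soon as an element of [X] lies in ]n, m]. *)
Definition slow_group (F : set_system nat) (X : set nat) : set Sym :=
  [set p : Sym | exists2 A, F A & forall n m x, A n -> A m -> separated X n m ->
             x < n -> (p x < m) && (sym_inv p x < m)].

(** A colouring of [nat] that changes colour exactly at the elements of [D]:
    between two points of equal colour, [D] has either no element or at least
    two. *)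
Lemma alternating_colouring (D : set nat) : exists e : nat -> bool,
  forall n m, separated D n m -> e n = e m ->
  exists d d', [/\ D d, D d', n < d, d < d' & d' <= m].
Proof.
pose e := fix e n := if n is n'.+1 then e n' (+) `[< D n >] else false.
exists e => n m [b Db /andP[nb bm]] enm.
have : [\/ ~ separated D n m /\ e m = e n, separated D n m /\ e m = ~~ e n |
         exists d d', [/\ D d, D d', n < d, d < d' & d' <= m]].
  have : n <= m by lia.
  elim: m {b Db nb bm enm} => [|m IHm] nm.
    by constructor 1; split; [move=> [d _]; lia|have -> : n = 0 by lia].
  have [nm'|mn] := leqP n m; last first.
    by constructor 1; split; [move=> [d _]; lia|have -> : n = m.+1 by lia].
  have em : e m.+1 = e m (+) `[< D m.+1 >] by [].
  have [Dm|nDm] := pselect (D m.+1).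
    rewrite em asboolT // addbT; have [[nsep ->]|[[d Dd ndm] ->]|] := IHm nm'.
    - by constructor 2; split=> //; exists m.+1 => //; lia.
    - by constructor 3; exists d, m.+1; split=> //; lia.
    - by move=> [d [d' [? ? ? ? ?]]]; constructor 3; exists d, d'; split=> //; lia.
  rewrite em asboolF // addbF.
  have -> : separated D n m.+1 = separated D n m.
    rewrite propeqE; split => -[d Dd ndm]; exists d => //; last by lia.
    suff : d != m.+1 by lia.
    by apply/eqP => dm; apply: nDm; rewrite -dm.
  have [?|?|] := IHm nm'; [by constructor 1|by constructor 2|].
  by move=> [d [d' [? ? ? ? ?]]]; constructor 3; exists d, d'; split=> //; lia.
case=> [[]|[_ em]|//]; first by case; exists b => //; lia.
by move: enm; rewrite em; case: (e n).
Qed.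

Lemma slow_group_subgroup F X : UltraFilter F -> subgroup (slow_group F X).
Proof.
move=> FU; split.
  rewrite inE; exists setT; first exact: filterT.
  by move=> n m x _ _ [b _ nbm] xn /=; lia.
move=> p q; rewrite !inE => -[A FA pA] [A' FA' qA'].
pose C := A `&` A'.
pose D := [set d | C d /\ forall a, C a -> a < d -> separated X a d].
(* [D] consists of the least element of [C] in each interval between
   consecutive elements of [X]. *)
have D_between n m : C n -> C m -> separated X n m -> separated D n m.
  move=> Cn Cm [b Xb nbm].
  pose P d := `[< C d /\ ~ separated X d m >].
  have Pm : P m by apply/asboolP; split=> // -[b' _]; lia.
  case: (ex_minnP (ex_intro _ m Pm)) => d /asboolP[Cd nsep] dmin.
  have dm := dmin m Pm.
  exists d; last first.
    rewrite dm andbT ltnNge; apply/negP => dn.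
    by apply: nsep; exists b => //; lia.
  split=> // a Ca ad.
  have [b' Xb' ab'] : separated X a m.
    apply: contrapT => nsep'; suff /dmin : P a by lia.
    exact/asboolP.
  exists b' => //; suff : ~~ (d < b') by lia.
  by apply/negP => db'; apply: nsep; exists b' => //; lia.
have [e eP] := alternating_colouring D.
(* On a monochromatic subset of [C] a separated pair n < m admits d in [C] with
   n, d and d, m separated: one permutation maps [0, n[ into [0, d[ and the
   other maps [0, d[ into [0, m[. *)
have mono (E : set nat) : E `<=` C ->
    (forall n m, E n -> E m -> e n = e m) -> F E -> slow_group F X (p / q)%g.
  move=> EC Ee FE; exists E => // n m x En Em nm xn.
  have [Cn Cm] := (EC _ En, EC _ Em).
  have [d [d' [[Cd dsep] [_ d'sep] nd dd' d'm]]] :=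
    eP n m (D_between n m Cn Cm nm) (Ee n m En Em).
  have nd_sep := dsep n Cn nd.
  have dm_sep := separated_widen (leqnn d) d'm (d'sep d Cd dd').
  have /andP[px pix] := pA n d x Cn.1 Cd.1 nd_sep xn.
  have /andP[qx qix] := qA' n d x Cn.2 Cd.2 nd_sep xn.
  have /andP[ppx _] := pA d m _ Cd.1 Cm.1 dm_sep qix.
  have /andP[qqx _] := qA' d m _ Cd.2 Cm.2 dm_sep pix.
  by apply/andP; split.
have FC : F C by exact: filterI.
have [Fe|Fe] := in_ultra_setVsetC [set n | e n] FU.
  apply: (mono (C `&` [set n | e n])); [by move=> n []| |exact: filterI].
  by move=> n m [_ /= ->] [_ /= ->].
apply: (mono (C `&` ~` [set n | e n])); [by move=> n []| |exact: filterI].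
by move=> n m [_ /negP/negbTE ->] [_ /negP/negbTE ->].
Qed.

(** For a given [n] the points separated from [n] by [X] form an upper set, and
    likewise for [Y], so one of the two contains the other; which one it is does
    not depend on [n] along a set of [F]. *)
Lemma slow_group_total F X Y : UltraFilter F ->
  slow_group F X `<=` slow_group F Y \/ slow_group F Y `<=` slow_group F X.
Proof.
move=> FU.
have compare Z Z' : F [set n | forall m, separated Z' n m -> separated Z n m] ->
    slow_group F Z `<=` slow_group F Z'.
  move=> FZ p [A FA pA].
  exists (A `&` [set n | forall m, separated Z' n m -> separated Z n m]).
    exact: filterI.
  by move=> n m x [An nZ] [Am _] /nZ; exact: pA.
have [FXY|FnXY] :=
  in_ultra_setVsetC [set n | forall m, separated Y n m -> separated X n m] FU.
  by left; exact: compare.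
right; apply: compare; apply: filterS FnXY => n /existsNP[m0 /not_implyP].
move=> [[b Yb nb] nX] m [a Xa na]; exists b => //.
have : ~~ (a <= m0) by apply/negP => am0; apply: nX; exists a => //; lia.
by lia.
Qed.

Lemma le_star_bound (x y : nat -> nat) :
  le_star x y -> exists N, forall n, N <= n -> x n <= y n.
Proof.
move=> /finite_seqP[s sE]; exists (\max_(i <- s) i).+1 => n sn.
apply: contrapT => /negP nxy.
have : [set n | ~~ (x n <= y n)] n by [].
rewrite sE /= => ns; have := @leq_bigmax_seq _ s xpredT id n ns isT; lia.
Qed.

Lemma S_sub_slow_group F X f : nonprincipal_ultrafilter F -> increasing f ->
  F [set n | forall b, X b -> n < b -> f n < b] ->
  S_ f `<=` slow_group F X.
Proof.
move=> Fnp f_inc FX; have [FU _] := Fnp.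
apply: smallest_sub; first exact: slow_group_subgroup.
move=> p [/le_star_bound[N pN] /le_star_bound[N' pN']].
pose M := \max_(x < maxn N N') maxn (p x) (sym_inv p x).
exists ([set n | forall b, X b -> n < b -> f n < b] `&` [set n | M < n]).
  exact: filterI FX (ultrafilter_cofinite M.+1 Fnp).
move=> n m x [nX /= Mn] [_ /= Mm] [b Xb nbm] xn.
have [xN|Nx] := ltnP x (maxn N N').
  have : maxn (p x) (sym_inv p x) <= M by exact: (leq_bigmax (Ordinal xN)).
  by lia.
have fnb : f n < b by apply: nX => //; lia.
have fx : f x < f n by exact: f_inc.
have px := pN x; have pix : sym_inv p x <= f x by apply: pN'; lia.
by lia.
Qed.

Lemma S_cover (p : Sym) : exists2 f, increasing f & S_ f p.
Proof.
pose g n := \max_(i < n.+1) maxn (p i) (sym_inv p i).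
have gP m n : m <= n -> maxn (p m) (sym_inv p m) <= g n.
  by move=> mn; exact: (leq_bigmax (Ordinal (mn : m < n.+1))).
have g_mono m n : m <= n -> g m <= g n.
  by move=> mn; apply/bigmax_leqP => i _; apply: gP; have := ltn_ord i; lia.
exists (fun n => g n + n).
  by move=> m n mn; have := g_mono m n; lia.
apply: sub_gen_smallest; split; rewrite /le_star.
  rewrite (_ : [set _ | _] = set0) // -subset0 => n /=.
  by have := gP n n (leqnn n); lia.
rewrite (_ : [set _ | _] = set0) // -subset0 => n /=.
by have := gP n n (leqnn n); lia.
Qed.

(** * Properness and Q-points *)

Lemma lift_sym (c : nat -> nat) (t : Sym) : injective c ->
  exists p : Sym, forall i, p (c i) = c (t i) /\ sym_inv p (c i) = c (sym_inv t i).
Proof.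
move=> c_inj.
have /choice[d dP] x : exists o : option nat,
    if o is Some i then c i = x else forall i, c i <> x.
  have [[i ci]|nc] := pselect (exists i, c i = x); first by exists (Some i).
  by exists None => i ci; apply: nc; exists i.
have dc i : d (c i) = Some i.
  by have := dP (c i); case: (d (c i)) => [j /c_inj ->|/(_ i)].
pose lift g x := if d x is Some i then c (g i) else x.
have liftK g g' : cancel g g' -> cancel (lift g) (lift g').
  move=> gK x; rewrite /lift; have := dP x; case dx: (d x) => [i|].
    by move=> <-; rewrite dc gK.
  by rewrite dx.
exists (MkSym (liftK _ _ (@sym_funK t)) (liftK _ _ (@sym_invK t))) => i /=.
by rewrite /lift dc.
Qed.

(** Translation by one step along [nat] arranged as the two-sided line
    ... 3, 1, 0, 2, 4 ...: even numbers move up and odd ones down, by two except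
    at the junction, where 1 goes to 0. *)
Definition shift_right n := if odd n then if n == 1 then 0 else n - 2 else n + 2.

Definition shift_left n := if odd n then n + 2 else if n == 0 then 1 else n - 2.

Lemma shift_rightK : cancel shift_right shift_left.
Proof.
move=> n; rewrite /shift_right /shift_left; case: (boolP (odd n)) => odd_n.
  case: (n =P 1) => [->//|n1].
  have -> : odd (n - 2) = true by lia.
  by lia.
have -> : odd (n + 2) = false by lia.
by case: eqP; lia.
Qed.

Lemma shift_leftK : cancel shift_left shift_right.
Proof.
move=> n; rewrite /shift_right /shift_left; case: (boolP (odd n)) => odd_n.
  have -> : odd (n + 2) = true by lia.
  by case: eqP; lia.
case: (n =P 0) => [->//|n0].
have -> : odd (n - 2) = false by lia.
by lia.
Qed.

Definition two_sided_shift : Sym := MkSym shift_rightK shift_leftK.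

Lemma two_sided_shift_large i :
  two_sided_shift i = i + 2 \/ sym_inv two_sided_shift i = i + 2.
Proof. by rewrite /= /shift_right /shift_left; case: (odd i); [right|left]. Qed.

Lemma escaping_permutation (u : nat -> nat) : exists p : Sym,
  forall n, 0 < n -> exists2 x, x < n & u n <= maxn (p x) (sym_inv p x).
Proof.
pose v n := \max_(i < n.+1) u i.
have [|c [c_inc c0 _ cv]] := @sparse_seq setT v; first by move=> n; exists n.+1.
have c_inj : injective c.
  by move=> i j cij; have [/c_inc|/c_inc|//] := ltngtP i j; rewrite cij ltnn.
have [p pP] := lift_sym two_sided_shift c_inj.
exists p => n n0; have [|i cin] := @block_exists c n.-1 c_inc; first by rewrite c0.
exists (c i); first by lia.
have un : u n <= v (c i.+1).
  have n_lt : n < (c i.+1).+1 by lia.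
  exact: (leq_bigmax (Ordinal n_lt)).
(* [n] lies in ]c i, c (i + 1)], and [p] or its inverse takes [c i] to
   [c (i + 2)], which exceeds v (c (i + 1)) >= u n. *)
have := cv i.+1; have [-> ->] := pP i; rewrite -addn2.
by have [->|->] := two_sided_shift_large i; lia.
Qed.

(** The largest positive element of [X] that is at most [n], or 0. *)
Fixpoint last_in (X : set nat) n :=
  if n is n'.+1 then if `[< X n >] then n else last_in X n' else 0.

Lemma last_in_leq X n : last_in X n <= n.
Proof. by elim: n => //= n IHn; case: asboolP => // _; lia. Qed.

Lemma last_in_mem X n : 0 < last_in X n -> X (last_in X n).
Proof. by elim: n => //= n IHn; case: asboolP. Qed.

Lemma last_in_max X b n : X b -> b <= n -> b <= last_in X n.
Proof.
move=> Xb; elim: n => [|n IHn]; first by rewrite leqn0 => /eqP ->.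
rewrite /=; case: asboolP => // nX; rewrite leq_eqVlt => /predU1P[bn|]; last exact: IHn.
by case: nX; rewrite -bn.
Qed.

Lemma last_in_mono X : {homo last_in X : m n / m <= n}.
Proof.
move=> m n mn; have [->//|/last_in_mem Xm] := posnP (last_in X m).
by apply: last_in_max => //; exact: leq_trans (last_in_leq X m) mn.
Qed.

Lemma last_in_fix X b : X b -> last_in X b = b.
Proof. by move=> Xb; apply/eqP; rewrite eqn_leq last_in_leq last_in_max. Qed.

Lemma last_in_idem X n : last_in X (last_in X n) = last_in X n.
Proof.
by have [->//|/last_in_mem /last_in_fix] := posnP (last_in X n).
Qed.

Lemma coherent_last_in F X : (forall n, exists2 b, X b & n < b) ->
  coherent F (fmap (last_in X) F).
Proof.
move=> X_unb.
have [|k [k_inc k0 kX _]] := @sparse_seq X id; first exact: X_unb.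
have kfix t : last_in X (k t) = k t.
  by case: t => [|t]; [rewrite k0|exact: last_in_fix].
have block n t : (k t <= last_in X n < k t.+1) = (k t <= n < k t.+1).
  have snn := last_in_leq X n.
  have lo : k t <= n -> k t <= last_in X n by move/(last_in_mono X); rewrite kfix.
  have hi : k t.+1 <= n -> k t.+1 <= last_in X n.
    by move/(last_in_mono X); rewrite kfix.
  by lia.
exists k => // I; rewrite /fmap /=.
rewrite (_ : last_in X @^-1` block_union k I = block_union k I) //.
rewrite predeqE => n; split => -[t It /= kt]; exists t => //=.
  by rewrite -block.
by rewrite block.
Qed.

(** If the group is everything, it contains a permutation escaping faster than
    the fibres of a given monotone surjection [phi]; the image under [last_in X]
    of a set witnessing this membership then has at most one point in each fibre
    of [phi]. *)
Lemma Q_point_of_slow_group_setT F X : nonprincipal_ultrafilter F ->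
  (forall n, exists2 b, X b & n < b) -> slow_group F X = setT ->
  Q_point (fmap (last_in X) F).
Proof.
move=> Fnp X_unb GT; have [FU _] := Fnp; set s := last_in X.
split.
  split; first exact: pushforward_ultrafilter.
  move=> n Qn; have : F (s @^-1` [set n]).
    have : principal_filter n [set n] by exact/principal_filterP.
    by rewrite -Qn.
  have [b Xb nb] := X_unb n.
  move=> /(filterI (ultrafilter_cofinite b Fnp))/filter_ex[m [/= bm smn]].
  by have := last_in_max Xb bm; rewrite -/s smn; lia.
move=> phi phi_mono phi_surj.
have /choice[u uP] n : exists b, phi n < phi (s b).
  have [y _ phiy] : range phi (phi n).+1 by rewrite phi_surj.
  have [b Xb yb] := X_unb y.
  by exists b; rewrite /s last_in_fix // -phiy; apply: phi_mono; exact: ltnW.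
(* Separated points n < m of a witness [A] for [p] satisfy u n <= m, so that the
   [X]-interval of [m] starts beyond the fibre of [phi] through [n]. *)
have [p pP] := escaping_permutation u.
have [A FA pA] : slow_group F X p by rewrite GT.
exists (s @` (A `&` [set n | 0 < n])).
  rewrite /fmap /=.
  by apply: filterS (filterI FA (ultrafilter_cofinite 1 Fnp)) => n An; exists n.
suff no_collision x y : (s @` (A `&` [set n | 0 < n])) x ->
    (s @` (A `&` [set n | 0 < n])) y -> x < y -> phi x <> phi y.
  move=> x y; rewrite !inE => Ax Ay phixy.
  have [xy|yx|//] := ltngtP x y.
    by case: (no_collision x y Ax Ay xy).
  by case: (no_collision y x Ay Ax yx).
move=> [n [An n0] <-] [m [Am m0] <-] smn phi_eq.
have nm : n < s m.
  rewrite ltnNge; apply/negP => /(last_in_mono X).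
  by rewrite last_in_idem -/s; lia.
have sep : separated X n m.
  exists (s m); first by apply: last_in_mem; rewrite -/s; lia.
  by rewrite nm last_in_leq.
have [z zn uz] := pP n n0.
have um : u n <= m by have := pA n m z An Am sep zn; lia.
have := uP n; have := phi_mono _ _ (last_in_mono X um).
by have := phi_mono _ _ (last_in_leq X n); rewrite -/s; lia.
Qed.

Lemma slow_group_proper F X : nonprincipal_ultrafilter F ->
  (forall n, exists2 b, X b & n < b) ->
  ~ (exists Q, Q_point Q /\ coherent F Q) -> slow_group F X <> setT.
Proof.
move=> Fnp X_unb noQ GT; apply: noQ; exists (fmap (last_in X) F); split.
  exact: Q_point_of_slow_group_setT.
exact: coherent_last_in.
Qed.

(** * Well-ordered chains of subgroups *)

Section WellOrder.
Variables (L : Type) (R : rel L).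
Hypothesis R_wo : well_order R.

Lemma wo_min (P : set L) : P !=set0 -> exists2 z, P z & forall x, P x -> R z x.
Proof.
move=> [x Px]; have [|z [[zP zmin] _]] := R_wo (A := [pred x | `[< P x >]]).
  by exists x; exact/asboolP.
exists z; first exact/asboolP.
by move=> y Py; apply: zmin; exact/asboolP.
Qed.

Lemma wo_anti x y : R x y -> R y x -> x = y.
Proof.
move=> Rxy Ryx.
have refl z : R z z.
  by have [|w -> wmin] := @wo_min [set z]; [exists z|exact: wmin].
have [|z [_ zuniq]] := R_wo (A := [pred z | `[< z = x \/ z = y >]]).
  by exists x; apply/asboolP; left.
rewrite -(zuniq x) ?(zuniq y) //; split; try by apply/asboolP; auto.
  by move=> w /asboolP[] ->.
by move=> w /asboolP[] ->.
Qed.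

Lemma strict_trans x y z : strict R x y -> strict R y z -> strict R x z.
Proof.
rewrite /strict => yx zy; apply/negP => zx.
have [|w] := @wo_min [set w | [\/ w = x, w = y | w = z]].
  by exists x; constructor 1.
case=> -> wmin.
- have Rxz : R x z by apply: wmin; constructor 3.
  have xz := wo_anti Rxz zx; move: zy; rewrite -xz wmin //; by constructor 2.
- by move/negP: yx; apply; apply: wmin; constructor 1.
- by move/negP: zy; apply; apply: wmin; constructor 2.
Qed.

Lemma strict_homo_ge (g : L -> L) :
  {homo g : x y / strict R x y} -> forall x, ~ strict R (g x) x.
Proof.
move=> g_homo x gx.
have [|z gz zmin] := @wo_min [set x | strict R (g x) x]; first by exists x.
by have := zmin (g z) (g_homo _ _ gz); apply/negP.
Qed.

End WellOrder.

(** A family of subgroups indexed by a proper initial segment of [cf^*] need not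
    increase along the well order to contradict minimality: if inclusion is
    linear on it, it increases strictly on the indices whose subgroup properly
    contains all the earlier ones, and these subgroups are cofinal. *)
Lemma no_short_chain (L : Type) (R : rel L) (i : L) (G : L -> set Sym) :
  is_cfstar R ->
  (forall j, strict R j i -> subgroup (G j) /\ G j <> setT) ->
  (forall j j', strict R j i -> strict R j' i ->
     G j `<=` G j' \/ G j' `<=` G j) ->
  (forall f, increasing f -> exists2 j, strict R j i & S_ f `<=` G j) -> False.
Proof.
move=> [R_wo _ R_min] G_prop G_tot G_S.
pose record j := strict R j i /\ forall j', strict R j' j -> G j' `<` G j.
pose L' := {j : L | record j}.
pose R' : rel L' := fun a b => R (sval a) (sval b).
have R'_wo : well_order R'.
  move=> A [a aA].
  have [|z [b bA <-] zmin] := @wo_min _ _ R_wo [set sval b | b in [set b | b \in A]].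
    by exists (sval a), a.
  exists b; split.
    by split=> // b' b'A; apply: zmin; exists b'.
  move=> b' [b'A b'min].
  have /(wo_anti R_wo) : R (sval b) (sval b') by apply: zmin; exists b'.
  by move=> /(_ (b'min b bA)) /eq_sig_hprop; apply => x; exact: Prop_irrelevance.
have to_record j : strict R j i -> exists a : L', G j `<=` G (sval a).
  move=> ji.
  have [|z [zi Gjz] zmin] := @wo_min _ _ R_wo [set z | strict R z i /\ G j `<=` G z].
    by exists j; split.
  suff rz : record z by exists (exist _ z rz).
  split=> // j' j'z; have j'i := strict_trans R_wo j'z zi.
  have nGj : ~ G z `<=` G j'.
    move=> Gz; move/negP: j'z; apply; apply: zmin; split=> //.
    exact: subset_trans Gjz Gz.
  by split=> //; have [//|] := G_tot _ _ zi j'i.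
have ch : cfstar_chain R' (fun a : L' => G (sval a)).
  split.
  - by move=> [j [ji rj]]; exact: G_prop.
  - by move=> [j rj] [j' [j'i rj']] /=; exact: rj'.
  - rewrite -subTset => p _; have [f f_inc Sp] := S_cover p.
    have [j ji SG] := G_S f f_inc; have [a Ga] := to_record j ji.
    by exists a => //; apply: Ga; exact: SG.
  - move=> f f_inc; have [j ji SG] := G_S f f_inc; have [a Ga] := to_record j ji.
    by exists a; exact: subset_trans SG Ga.
have [g g_homo] := R_min _ _ _ R'_wo ch.
apply: (strict_homo_ge R_wo (g := fun x => sval (g x))) (_ : strict R _ i).
  by move=> x y xy; exact: g_homo.
by case: (g i) => j [].
Qed.

(** If [F] did not capture the ultrafilter generated by [B], the groups attached
    to [F] and the members of [B] would contradict the minimality of [cf^*]. *)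
Lemma captures_of_small_base (L : Type) (R : rel L) (i : L)
    (B : set (set nat)) (e : L -> set nat) F :
  is_cfstar R -> set_bij [set j | strict R j i] B e -> ultrafilter_base B ->
  nonprincipal_ultrafilter F -> ~ (exists Q, Q_point Q /\ coherent F Q) ->
  exists h, captures F (filter_from B id) h.
Proof.
move=> hL [eB _ e_surj] Vnp Fnp noQ; have [[FU _] [VU _]] := (Fnp, Vnp).
apply: contrapT => /forallNP ncapt.
have B_unb X : B X -> forall n, exists2 b, X b & n < b.
  move=> BX n; have VX : filter_from B id X by exists X.
  have [b [Xb nb]] := filter_ex (filterI VX (ultrafilter_cofinite n.+1 Vnp)).
  by exists b.
apply: (no_short_chain (i := i) (G := fun j => slow_group F (e j)) hL).
- move=> j ji; split; first exact: slow_group_subgroup.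
  by apply: slow_group_proper => //; apply: B_unb; exact: eB.
- by move=> j j' _ _; exact: slow_group_total.
- move=> f f_inc; have /existsNP[X /not_implyP[[Y BY YX] nFX]] := ncapt f.
  have [j ji eY] := e_surj Y BY; exists j => //.
  apply: S_sub_slow_group => //.
  have [//|] := in_ultra_setVsetC [set n | exists2 b, X b & n < b <= f n] FU.
  apply: filterS => n nX b; rewrite eY => /YX Xb nb.
  by rewrite ltnNge; apply/negP => bf; apply: nX; exists b => //; rewrite nb.
Qed.

Theorem corollary1p9 (K : Type) (L : Type) (R : rel L)
    (hK : is_u K) (hL : is_cfstar R)
    (hlt : card_lt_ordinal K R) :
  (forall F U : set_system nat,
     nonprincipal_ultrafilter F -> nonprincipal_ultrafilter U ->
     ~ (exists Q, Q_point Q /\ coherent F Q) ->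
     ~ (exists Q, Q_point Q /\ coherent U Q) ->
     coherent F U)
  /\ (~ (exists Q, Q_point Q) -> NCF).
Proof.
have coh F U : nonprincipal_ultrafilter F -> nonprincipal_ultrafilter U ->
    ~ (exists Q, Q_point Q /\ coherent F Q) ->
    ~ (exists Q, Q_point Q /\ coherent U Q) -> coherent F U.
  move=> Fnp Unp FQ UQ.
  have [[B Bbase KB] _] := hK; have [i Ki] := hlt.
  have /card_set_bijP[e e_bij] : ([set j | strict R j i] #= B)%card.
    by apply: card_eq_trans KB; rewrite card_eq_sym.
  have [h FV] := captures_of_small_base hL e_bij Bbase Fnp FQ.
  have [h' UV] := captures_of_small_base hL e_bij Bbase Unp UQ.
  exact: coherent_of_captures Fnp Unp Bbase FV UV.
split=> // noQ F U Fnp Unp.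
by apply: coh => // -[Q [Qpt _]]; apply: noQ; exists Q.
Qed.
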